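(* Let $P=(Z,<)$ be a causal set. If $P\setminus A$ has finitely many minimal elements for every stem $A$ of $P$, then there is an order-invariant measure on $P$. More generally, if for some infinite down-set $Y$ of $P$ the restriction $P_Y$ has the property that $P_Y\setminus A$ has finitely many minimal elements for every stem $A$ of $P_Y$, then there is an order-invariant measure on $P$.
   Context: A causal set is a partially ordered set $P=(Z,<)$ with $Z$ countably infinite such that $\{y: y<z\}$ is finite for every $z\in Z$. A down-set is a subset closed downwards; a stem is a finite down-set. For $W\subseteq Z$, $P_W$ is the restriction of $P$ to $W$ and $P\setminus W=P_{Z\setminus W}$. An ordered stem is a finite string $a_1\cdots a_k$ of distinct elements such that $\{a_1,\dots,a_k\}$ is a down-set and $a_i<a_j$ implies $i<j$. $\Omega^P$ is the set of infinite strings $\omega=x_1x_2\cdots$ of elements of $Z$ such that each $x_k$ is a minimal element of $P\setminus\{x_1,\dots,x_{k-1}\}$ (these need not exhaust $Z$). The basic event $E(a_1\cdots a_k)$ is the set of $\omega\in\Omega^P$ beginning with $a_1\cdots a_k$, and $\mathcal{F}^P$ is the $\sigma$-field generated by basic events. An order-invariant measure on $P$ is a probability measure $\mu$ on $(\Omega^P,\mathcal{F}^P)$ such that whenever $a_1\cdots a_k$ and $a_{s(1)}\cdots a_{s(k)}$ are both ordered stems ($s$ a permutation of $\{1,\dots,k\}$), $\mu(E(a_1\cdots a_k))=\mu(E(a_{s(1)}\cdots a_{s(k)}))$. *)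

(* Defs.v *)
From HB Require Import structures.
From mathcomp Require Import all_boot all_order all_algebra perm.
From mathcomp Require Import finmap.
From mathcomp Require Import all_classical all_reals all_analysis.

Set Implicit Arguments.
Unset Strict Implicit.
Unset Printing Implicit Defensive.

Import Order.TTheory.

Local Open Scope classical_set_scope.
Local Open Scope order_scope.

HB.mixin Record POrder_isCausalSet (d : Order.disp_t) Z & Order.POrder d Z := {
  causal_denumerable : ([set: Z] #= [set: nat])%card ;
  causal_past_finite : forall z : Z, finite_set [set y : Z | y < z]
}.

#[short(type="causalSetType")]
HB.structure Definition CausalSet (d : Order.disp_t) :=
  {Z of Order.POrder d Z & POrder_isCausalSet d Z}.

(* A subset [W] stands for the restriction P_W; P itself is [W = setT], and
   P_W minus A is the restriction to [W `\` A]. *)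
Section Restriction.
Context {d : Order.disp_t} {Z : porderType d}.
Implicit Types W A : set Z.

Definition minimals W : set Z :=
  [set z | W z /\ forall y, W y -> ~ (y < z)].

Definition down_set W A : Prop :=
  A `<=` W /\ forall x y, A x -> W y -> y < x -> A y.

Definition stem W A : Prop := finite_set A /\ down_set W A.

End Restriction.

Section Strings.
Context {d : Order.disp_t} {Z : porderType d}.

Definition ordered_stem (k : nat) (a : k.-tuple Z) : Prop :=
  [/\ uniq a,
      down_set setT [set` a] &
      forall i j : 'I_k, tnth a i < tnth a j -> (i < j)%N].

(* Strings are indexed from 0. *)
Definition infinite_strings : set (nat -> Z) :=
  [set x | forall k, minimals (setT `\` (x @` `I_k)) (x k)].

End Strings.

(* [Omega Z] has to be a pointed type to carry a [measurableType] structure, so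
   [infinite_strings] is shown to be nonempty. *)
Section Nonempty.
Context {d : Order.disp_t} {Z : causalSetType d}.

Lemma minimals_neq0 (W : set Z) : W !=set0 -> minimals W !=set0.
Proof.
move=> [w Ww].
have [n] := ubnP #|` fset_set [set y : Z | y < w]|%fset.
elim: n => // n IHn in w Ww *; rewrite ltnS => le_n.
have [[y [Wy yw]]|noy] := pselect (exists y, W y /\ y < w); last first.
  by exists w; split=> // y Wy yw; apply: noy; exists y.
apply: (IHn y Wy); apply: leq_trans le_n; apply: fproper_ltn_card.
have finP := @causal_past_finite d Z.
rewrite fproperE; apply/andP; split.
  apply/fsubsetP => z; rewrite !in_fset_set ?inE //=.
  by move=> zy; apply: lt_trans yw.
apply/negP => /fsubsetP/(_ y).
by rewrite !in_fset_set ?inE //= ltxx => /(_ yw).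
Qed.

Lemma infinite_strings_neq0 : @infinite_strings d Z !=set0.
Proof.
have infZ : infinite_set [set: Z].
  by rewrite (eq_finite_set (@causal_denumerable d Z)); exact: infinite_nat.
have [z0 _] := infinite_setN0 infZ.
pose next (s : seq Z) := xget z0 (minimals (setT `\` [set` s])).
have nextP s : minimals (setT `\` [set` s]) (next s).
  suff: minimals (setT `\` [set` s]) !=set0.
    by move=> [z zP]; apply: xgetPex; exists z.
  apply: minimals_neq0; apply: infinite_setN0.
  by apply: infinite_setD => //; exact: finite_seq.
pose hist := fix hist n := if n is m.+1 then next (hist m) :: hist m else [::].
exists (fun n => next (hist n)) => k /=.
suff -> : (fun n => next (hist n)) @` `I_k = [set` hist k] by exact: nextP.
elim: k => [|k IHk]; first by rewrite II0 image_set0 /=; apply/seteqP; split.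
rewrite IIS image_setU IHk image_set1 /=; apply/seteqP; split=> z /=.
- by case=> [zh|->]; rewrite inE ?eqxx // zh orbT.
- by rewrite inE => /orP[/eqP ->|zh]; [right|left].
Qed.

End Nonempty.

Definition Omega (d : Order.disp_t) (Z : causalSetType d) : Type :=
  {x : nat -> Z | infinite_strings x}.

Definition string (d : Order.disp_t) (Z : causalSetType d) (w : Omega Z) :
  nat -> Z := sval w.

Definition some_Omega (d : Order.disp_t) (Z : causalSetType d) : Omega Z :=
  let: exist x xP := cid infinite_strings_neq0 in exist _ x xP.

HB.instance Definition _ (d : Order.disp_t) (Z : causalSetType d) :=
  gen_eqMixin (Omega Z).
HB.instance Definition _ (d : Order.disp_t) (Z : causalSetType d) :=
  gen_choiceMixin (Omega Z).
HB.instance Definition _ (d : Order.disp_t) (Z : causalSetType d) :=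
  isPointed.Build (Omega Z) (some_Omega Z).

Section OrderInvariance.
Context {d : Order.disp_t} {Z : causalSetType d}.

Definition basic_event (k : nat) (a : k.-tuple Z) : set (Omega Z) :=
  [set w | forall i : 'I_k, string w i = tnth a i].

Definition basic_events : set (set (Omega Z)) :=
  [set E | exists (k : nat) (a : k.-tuple Z),
             ordered_stem a /\ E = basic_event a].

Definition order_invariant {R : realType}
    (mu : probability (g_sigma_algebraType basic_events) R) : Prop :=
  forall (k : nat) (a : k.-tuple Z) (s : 'S_k),
    let b := [tuple tnth a (s i) | i < k] in
    ordered_stem a -> ordered_stem b ->
    mu (basic_event a) = mu (basic_event b).

End OrderInvariance.

Arguments basic_events {d} Z.

(* Main.v *)
Require Import Defs.
From HB Require Import structures.
From mathcomp Require Import all_boot all_order all_algebra perm.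
From mathcomp Require Import finmap.
From mathcomp Require Import all_classical all_reals all_analysis.

(** An order-invariant measure supported on strings in [Y] amounts to a function
    [f >= 0] on stems of [Y] with [f] equal to 1 on the empty stem and
    [f A = \sum_z f (z |` A)], [z] ranging over the finitely many minimal
    elements of [P_Y \ A]; the basic event of an ordered stem in [Y] then has
    measure [f] of its underlying set, whatever the order of its elements.  The
    uniform distribution on the ordered stems of length [n] in [Y] gives such a
    function at levels below [n], since the number of extensions of an ordered
    stem depends only on its set of elements; a limit along an ultrafilter works at all levels, as finite branching
    lets the limit commute with the sum.  To realise [f] by a measure, cut
    [0, 1[ into consecutive intervals whose lengths are the values of [f] on
    the stems of size 1, cut these again, and so on: a point [v] of [0, 1[
    then determines a string, and the measure is the image of Lebesgue
    measure. *)

Set Implicit Arguments.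
Unset Strict Implicit.
Unset Printing Implicit Defensive.

Import Order.TTheory GRing.Theory Num.Theory.
Import numFieldNormedType.Exports.

Local Open Scope classical_set_scope.
Local Open Scope ring_scope.

Lemma fmap_ultra {S T : Type} (f : S -> T) (F : set_system S) :
  UltraFilter F -> UltraFilter (f @ F).
Proof.
move=> FU; split; first exact: fmap_proper_filter.
move=> G GF FG; apply/seteqP; split=> // A GA.
have [//|FnA] := in_ultra_setVsetC (f @^-1` A) FU.
have : G (A `&` ~` A) by apply: filterI => //; exact: FG.
by rewrite setICr => /filter_not_empty.
Qed.

Lemma fset_nil {T : choiceType} : [fset x in [::]]%fset = fset0 :> {fset T}.
Proof. by apply/fsetP => x; rewrite !inE. Qed.

(** * Random paths and harmonic functions *)

Section BranchingSets.
Context {T : choiceType}.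
Variable ch : {fset T} -> {fset T}.

(** [ch A] abstracts the minimal elements of P_Y \ A, so reachable sets play the role of stems. *)
Inductive reachable : {fset T} -> Prop :=
| reachable0 : reachable fset0
| reachableS A z : reachable A -> z \in ch A -> reachable (z |` A)%fset.

Hypothesis ch_notin : forall A z, reachable A -> z \in ch A -> z \notin A.
Hypothesis ch_neq0 : forall A, reachable A -> ch A != fset0.

Fixpoint path_count (n : nat) (A : {fset T}) : nat :=
  if n is m.+1 then (\sum_(z <- ch A) path_count m (z |` A)%fset)%N else 1%N.

Lemma path_count_gt0 n A : reachable A -> (0 < path_count n A)%N.
Proof.
elim: n A => [//|n IHn] A rA /=.
have /fset0Pn[z zA] := ch_neq0 rA.
rewrite (big_rem z)//= ltn_addr//.
by apply: IHn; exact: reachableS.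
Qed.

Section Harmonic.
Variable R : realType.

Definition harmonic (f : {fset T} -> R) :=
  forall A, reachable A -> f A = \sum_(z <- ch A) f (z |` A)%fset.

(* If [A] is reachable and has at most [n] elements, the probability that a
   uniformly random path of length [n] from [fset0] starts with a given path
   from [fset0] to [A]. *)
Definition path_ratio (n : nat) (A : {fset T}) : R :=
  (path_count (n - #|` A|) A)%:R / (path_count n fset0)%:R.

Lemma path_ratio_ge0 n A : 0 <= path_ratio n A.
Proof. by rewrite /path_ratio divr_ge0. Qed.

Lemma path_ratio0 n : path_ratio n fset0 = 1.
Proof.
rewrite /path_ratio cardfs0 subn0 divff// pnatr_eq0 -lt0n.
exact/path_count_gt0/reachable0.
Qed.

(** Below level [n] the recursion of [path_count] unfolds once; adding a child enlarges the set by
    one, so one step less remains. *)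
Lemma path_ratioS n A : reachable A -> (#|` A| < n)%N ->
  path_ratio n A = \sum_(z <- ch A) path_ratio n (z |` A)%fset.
Proof.
move=> rA An; rewrite /path_ratio -mulr_suml; congr (_ / _).
rewrite -(subnSK An)/= natr_sum big_seq [RHS]big_seq; apply: eq_bigr => z zA.
by rewrite cardfsU1 ch_notin.
Qed.

(** Along a path from [fset0] the ratio never increases: each one is a sum of nonnegative terms that
    includes the next. *)
Lemma path_ratio_le1 n A : reachable A -> (#|` A| <= n)%N -> path_ratio n A <= 1.
Proof.
elim => [|{}A z rA IH zA]; first by rewrite path_ratio0.
rewrite cardfsU1 ch_notin// add1n => An.
apply: le_trans (IH (ltnW An)).
rewrite [leRHS]path_ratioS// (big_rem z)//= lerDl.
by apply: sumr_ge0 => y _; exact: path_ratio_ge0.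
Qed.

Lemma exists_harmonic : exists f : {fset T} -> R,
  [/\ f fset0 = 1, forall A, 0 <= f A & harmonic f].
Proof.
have [U [UU ooU]] := ultraFilterLemma (@eventually_filter).
have near_oo A (P : nat -> Prop) : (forall n, (#|` A| < n)%N -> P n) ->
    \forall n \near U, P n.
  by move=> AP; apply: ooU; exists #|` A|.+1 => // n; exact: AP.
have cvg_ratio A : exists l : R,
    0 <= l /\ (reachable A -> path_ratio^~ A @ U --> l).
  (* The bound by 1 covers reachable sets only; elsewhere just nonnegativity is asked, and 0 is a
     witness. *)
  have [rA|nrA] := pselect (reachable A); last by exists 0.
  have := @segment_compact R 0 1; rewrite compact_ultra.
  move=> /(_ (path_ratio^~ A @ U)) [|| l [l01 Ul]].
  - exact: fmap_ultra.
  - apply: near_oo (A) _ _ => n An /=.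
    by rewrite in_itv/= path_ratio_ge0 path_ratio_le1// ltnW.
  - by exists l; split=> // ; move: l01; rewrite /= in_itv/= => /andP[].
have [f fP] := choice cvg_ratio.
have f_cvg A rA := (fP A).2 rA.
exists f; split=> [|A|A rA]; last 2 first.
- by have [] := fP A.
- apply: (cvg_unique _ (f_cvg _ rA)) => //.
  have : \sum_(z <- ch A | z \in ch A) path_ratio n (z |` A)%fset @[n --> U] -->
      \sum_(z <- ch A | z \in ch A) f (z |` A)%fset.
    apply: cvg_big; first exact: add_continuous.
    by move=> z zA; exact/f_cvg/reachableS.
  (* The recursion holds for [n] above the size of [A], hence eventually along [U]. *)
  rewrite -big_seq; apply: cvg_trans; apply: near_eq_cvg.
  by apply: near_oo (A) _ _ => n An; rewrite path_ratioS// -big_seq.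
- apply: (cvg_unique _ (f_cvg _ reachable0)) => //.
  apply: cvg_near_cst; apply: near_oo (@fset0 T) _ _ => n _.
  by rewrite path_ratio0.
Qed.

End Harmonic.

(** * Cutting intervals: from a real number to a string *)

Section Walk.
Variable R : realType.
Variables (x0 : T) (f : {fset T} -> R).
Hypothesis f_ge0 : forall A, 0 <= f A.
Hypothesis f_harmonic : harmonic f.

(* Cuts [0, \sum_(z <- s) w z[ into consecutive intervals of lengths [w z];
   returns the [z] whose interval contains [v], and the offset of [v] in it. *)
Fixpoint pick_part (w : T -> R) (s : seq T) (v : R) : T * R :=
  if s is z :: s' then
    if v < w z then (z, v) else pick_part w s' (v - w z)
  else (x0, v).

Lemma pick_partP w s v : 0 <= v < \sum_(z <- s) w z ->
  let zv := pick_part w s v in zv.1 \in s /\ 0 <= zv.2 < w zv.1.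
Proof.
elim: s v => [|z s IHs] v /=.
  by rewrite big_nil => /andP[/le_lt_trans] /[apply]; rewrite ltxx.
rewrite big_cons => /andP[v0 vs]; case: ltP => vz /=.
  by rewrite mem_head v0.
have [|sv ?] := IHs (v - w z); first by rewrite subr_ge0 vz ltrBlDl.
by split; rewrite // in_cons sv orbT.
Qed.

(** Here [c] is the total weight of the parts before [z]; [uniq s] excludes a second part labelled
    [z]. *)
Lemma pick_part_itv w s z : (forall y, 0 <= w y) -> uniq s -> z \in s ->
  exists c, [/\ 0 <= c, c + w z <= \sum_(y <- s) w y &
    forall v, 0 <= v < \sum_(y <- s) w y ->
      if c <= v < c + w z then pick_part w s v = (z, v - c)
      else (pick_part w s v).1 != z].
Proof.
move=> w0; elim: s => [//|y s IHs] /= /andP[ys us].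
have sum0 : 0 <= \sum_(j <- s) w j by apply: sumr_ge0.
rewrite in_cons; case: eqVneq => [-> _|zy /= zs].
  exists 0; rewrite big_cons add0r lerDl; split=> // v /andP[v0 vs].
  rewrite v0 subr0; case: ltP => //= vy.
  have [] := @pick_partP w s (v - w y); first by rewrite subr_ge0 vy ltrBlDl.
  by move=> + _; apply: contraTneq => ->.
have [c [c0 cs cP]] := IHs us zs.
exists (w y + c); rewrite big_cons; split.
- exact: addr_ge0.
- by rewrite -addrA lerD2l.
- move=> v /andP[v0 vs]; case: (ltP v (w y)) => vy.
    by rewrite leNgt (lt_le_trans vy) ?lerDl//= eq_sym.
  have := cP (v - w y); rewrite subr_ge0 vy ltrBlDl vs => /(_ isT).
  by rewrite lerBrDl ltrBlDl addrA -[v - _ - _]addrA -opprD.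
Qed.

Definition step (A : {fset T}) := pick_part (fun z => f (z |` A)%fset) (ch A).

Fixpoint walk (k : nat) (A : {fset T}) (v : R) : T :=
  let zv := step A v in
  if k is k'.+1 then walk k' (zv.1 |` A)%fset zv.2 else zv.1.

Fixpoint admissible (A : {fset T}) (a : seq T) : bool :=
  if a is z :: a' then (z \in ch A) && admissible (z |` A)%fset a' else true.

Lemma stepP A v : reachable A -> 0 <= v < f A ->
  let zv := step A v in zv.1 \in ch A /\ 0 <= zv.2 < f (zv.1 |` A)%fset.
Proof. by move=> rA; rewrite f_harmonic//; exact: pick_partP. Qed.

(** By induction on [a]: the interval for [z :: a] starts at [c + l], with [c] the left end of the
    part of [z] and [l] the offset within it of the interval for [a]. *)
Lemma walk_itv a A : reachable A ->
  let w := if admissible A a then f (A `|` [fset x in a])%fset else 0 in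
  exists l, [/\ 0 <= l, l + w <= f A &
    forall v, 0 <= v < f A ->
      (forall i, (i < size a)%N -> walk i A v = nth x0 a i) <->
      l <= v < l + w].
Proof.
elim: a A => [|z a IHa] A rA /=.
  by exists 0; rewrite add0r fset_nil fsetU0.
have [zA|zA] /= := boolP (z \in ch A); last first.
  (* A walk starts in [ch A], so no point follows [z :: a]: the interval is empty. *)
  exists 0; rewrite addr0; split=> // v /(stepP rA)[sA _]; split.
    by move=> /(_ 0%N isT)/= zE; rewrite zE (negbTE zA) in sA.
  by case/andP => /le_lt_trans /[apply]; rewrite ltxx.
have [l] := IHa _ (reachableS rA zA).
have -> : (z |` A `|` [fset x in a] = A `|` [fset x in z :: a])%fset.
  by apply/fsetP => y; rewrite !inE; case: (y == z); rewrite ?orbT.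
set w := (X in _ + X) => -[l0 lw lP].
have [c [c0 cw cP]] := pick_part_itv (fun y => f_ge0 (y |` A)%fset)
  (fset_uniq (ch A)) zA.
rewrite -f_harmonic// in cw cP.
exists (c + l); split; first exact: addr_ge0.
  by rewrite -addrA (le_trans _ cw)// lerD2l.
move=> v vA; have := cP v vA; rewrite -/(step A v).
case: ifPn => [/andP[cv vc] sE|nv sE].
  have vcA : 0 <= v - c < f (z |` A)%fset by rewrite subr_ge0 cv ltrBlDl.
  rewrite -lerBrDl -addrA -ltrBlDl; split=> [H|/(lP _ vcA) H [|i] ia] /=.
  - by apply/(lP _ vcA) => i ia; have := H i.+1 ia; rewrite /= sE.
  - by rewrite sE.
  - by rewrite sE; exact: H.
(* Outside the part of [z] both sides fail, as the smaller interval lies within that part. *)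
split=> [/(_ 0%N isT) /= zE|/andP[clv vclw]].
  by rewrite zE eqxx in sE.
case/negP: nv; rewrite (le_trans _ clv) ?lerDl//=.
by rewrite (lt_le_trans vclw)// -addrA lerD2l.
Qed.

End Walk.
End BranchingSets.

(** * Stems of P_Y as a branching structure *)

Section CausalChildren.
Context {d : Order.disp_t} {Z : causalSetType d}.
Variable Y : set Z.
Hypothesis Y_infinite : infinite_set Y.
Hypothesis Y_down : down_set setT Y.
Hypothesis Y_branching :
  forall A, stem Y A -> finite_set (minimals (Y `\` A)).

(** [fset_set] sends infinite sets to [fset0]; at reachable sets [Y_branching] rules this case
    out. *)
Definition children (A : {fset Z}) : {fset Z} :=
  fset_set (minimals (Y `\` [set` A])).

Lemma reachable_stem A : reachable children A -> stem Y [set` A].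
Proof.
elim => [|{}A z _ stemA].
  by split; [exact: finite_fset|split=> [x|x y]; rewrite /= inE].
rewrite in_fset_set ?inE; last exact: Y_branching.
have [_ [AY downA]] := stemA => -[[Yz Az] zmin].
split; first exact: finite_fset.
split=> [x|x y]; rewrite /= !inE.
- by case/orP => [/eqP -> //|/AY].
- case/orP => [/eqP ->|Ax] Yy yx; last by rewrite (downA x y) ?orbT.
  by apply/orP; right; apply: contrapT => Ay; exact: (zmin y (conj Yy Ay)).
Qed.

Lemma childrenP A z : reachable children A ->
  reflect (minimals (Y `\` [set` A]) z) (z \in children A).
Proof.
move=> /reachable_stem/Y_branching finA.
by rewrite in_fset_set//; exact: asboolP.
Qed.

Lemma children_notin A z :
  reachable children A -> z \in children A -> z \notin A.
Proof. by move=> rA /(childrenP _ rA)[[_ /negP]]. Qed.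

Lemma children_neq0 A : reachable children A -> children A != fset0.
Proof.
move=> rA; have [] := @minimals_neq0 _ _ (Y `\` [set` A]).
  by apply: infinite_setN0; apply: infinite_setD => //; exact: finite_fset.
by move=> z /(childrenP _ rA) zA; apply/fset0Pn; exists z.
Qed.

(** Nothing outside the down-set [Y] lies below an element of [Y]; this turns strings built in [Y]
    into strings of P. *)
Lemma minimals_down_set A : minimals (Y `\` A) `<=` minimals (setT `\` A).
Proof.
move=> z [[Yz Az] zmin]; split=> // y [_ Ay] yz.
by apply: (zmin y) => //; split=> //; apply: Y_down.2 yz.
Qed.

Lemma ordered_stem_admissible k (a : k.-tuple Z) : ordered_stem a ->
  admissible children fset0 a <-> [set` a] `<=` Y.
Proof.
move=> [uniq_a down_a incr_a]; split.
  suff adm (s : seq Z) A : reachable children A -> admissible children A s ->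
      [set` s] `<=` Y by apply/adm/reachable0.
  elim: s A => [//|z s IHs] A rA /= /andP[zA sA] x /=.
  rewrite inE => /predU1P[->|]; first by case/(childrenP _ rA) : zA => -[].
  by apply: IHs sA _; exact: reachableS.
move=> aY.
suff adm t s : s ++ t = a -> reachable children [fset x in s]%fset ->
    admissible children [fset x in s]%fset t.
  by rewrite -fset_nil; apply: adm => //; rewrite fset_nil; exact: reachable0.
elim: t s => [//|z t IHt] s st rs /=.
have za : z \in tval a by rewrite -st mem_cat mem_head orbT.
have zs : z \notin s.
  by move: uniq_a; rewrite -st cat_uniq /= negb_or => /and3P[_ /andP[]].
(* An element of [Y] below [z] belongs to the stem, hence precedes [z] in [a], hence lies in [s]. *)
have zch : z \in children [fset x in s]%fset.
  apply/childrenP => //; split=> [|y [Yy /=]].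
    by split; [exact: aY|rewrite /= !inE; exact/negP].
  rewrite !inE => /negP ys yz.
  have ya : y \in tval a by apply: down_a.2 yz.
  have ia x : x \in tval a -> (index x a < k)%N.
    by rewrite -index_mem size_tuple.
  have := incr_a (Ordinal (ia _ ya)) (Ordinal (ia _ za)).
  rewrite !(tnth_nth z)/= !nth_index// => /(_ yz).
  by rewrite -st !index_cat (negbTE ys) (negbTE zs)/= eqxx addn0 ltnNge leq_addr.
rewrite zch /=.
have zsE : (z |` [fset x in s] = [fset x in rcons s z])%fset.
  by apply/fsetP => y; rewrite !inE mem_rcons inE.
rewrite zsE; apply: IHt; first by rewrite cat_rcons.
by rewrite -zsE; exact: reachableS.
Qed.

Section CausalWalk.
Variable R : realType.
Variables (z0 : Z) (f : {fset Z} -> R).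
Hypothesis f0 : f fset0 = 1.
Hypothesis f_ge0 : forall A, 0 <= f A.
Hypothesis f_harmonic : harmonic children f.

(** Induction on [k] moves the first element of the walk from the image into [A]. *)
Lemma walk_minimal k A v : reachable children A -> 0 <= v < f A ->
  minimals (Y `\` ([set` A] `|` (fun i => walk children z0 f i A v) @` `I_k))
    (walk children z0 f k A v).
Proof.
elim: k A v => [|k IHk] A v rA vA.
  rewrite II0 image_set0 setU0.
  by have [/(childrenP _ rA)] := stepP z0 f_harmonic rA vA.
have [sA sv] := stepP z0 f_harmonic rA vA.
have := IHk _ _ (reachableS rA sA) sv; rewrite /=.
set z := (step _ _ _ _ _).1; set v' := (step _ _ _ _ _).2.
suff -> : [set` (z |` A)%fset] `|`
    (fun i => walk children z0 f i (z |` A)%fset v') @` `I_k =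
  [set` A] `|` (fun i => walk children z0 f i A v) @` `I_k.+1 by [].
apply/seteqP; split=> x /=.
- case=> [|[i ik <-]]; last by right; exists i.+1.
  by rewrite !inE => /orP[/eqP ->|]; [right; exists 0%N|left].
- case=> [xA|[[|i] ik <-]]; first by left; rewrite !inE xA orbT.
  + by left; rewrite !inE eqxx.
  + by right; exists i.
Qed.

Lemma walk_infinite_string v : 0 <= v < 1 ->
  infinite_strings (fun k => walk children z0 f k fset0 v).
Proof.
rewrite -f0 => v01 k; apply: minimals_down_set.
have := walk_minimal k (reachable0 _) v01.
by rewrite (_ : [set` fset0] = set0) ?set0U// -subset0 => x; rewrite /= inE.
Qed.

End CausalWalk.
End CausalChildren.

(** * Push-forward of Lebesgue measure on [0, 1[ *)

Section UnitIntervalPushforward.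
Local Open Scope ereal_scope.
Variable R : realType.

Lemma exists_unit_interval_probability :
  exists P : probability (measurableTypeR R) R,
    forall A, P A = lebesgue_measure (`[0%R, 1%R[ `&` A).
Proof.
have mD : measurable (`[0%R, 1%R[ : set (measurableTypeR R)).
  exact: measurable_itv.
pose m : {measure set (measurableTypeR R) -> \bar R} :=
  mrestr lebesgue_measure mD.
have mT : m setT = 1.
  rewrite /m /= /mrestr setTI lebesgue_measure_itv /= lte_fin ltr01.
  by rewrite oppr0 adde0.
(* The total mass is 1, so normalising changes no value; [dirac point] is the default for mass 0 or
   infinity. *)
exists (mnormalize m (dirac point)) => A.
rewrite /= /mnormalize [X in X == 0]mT [X in X == +oo]mT [X in fine X]mT /=.
by rewrite onee_eq0/= invr1 mule1 /m /= /mrestr setIC.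
Qed.

Lemma pushforward_unit_interval (T : pointedType) (G : set (set T))
    (X : R -> g_sigma_algebraType G) :
  (forall E, G E -> measurable (`[0%R, 1%R[ `&` X @^-1` E)) ->
  exists mu : probability (g_sigma_algebraType G) R,
    forall E, G E -> mu E = lebesgue_measure (`[0%R, 1%R[ `&` X @^-1` E).
Proof.
move=> mG.
have [P PE] := exists_unit_interval_probability.
(* [X] is controlled on [0, 1[ only; outside, [XD] takes the default [point], on a set of
   [P]-measure 0. *)
pose XD : measurableTypeR R -> g_sigma_algebraType G := X \_ `[0%R, 1%R[.
have mX : measurable_fun setT XD.
  have mD : measurable (`[0%R, 1%R[ : set (measurableTypeR R)).
    exact: measurable_itv.
  have mXD : measurable_fun (`[0%R, 1%R[ : set (measurableTypeR R)) X.
    by apply: (@measurability _ _ _ (g_sigma_algebraType G) _ _ G) => // _ [E GE <-]; exact: mG.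
  exact/(measurable_restrictT _ mD).
exists (distribution P (mfun_Sub (mem_set mX))) => E GE.
rewrite [LHS](PE (XD @^-1` E)); congr lebesgue_measure.
by apply/seteqP; split=> v /= [v01]; rewrite /XD patchT ?inE.
Qed.

End UnitIntervalPushforward.

(** * Construction of the order-invariant measure *)

Section OrderInvariantMeasure.
Context {d : Order.disp_t} {Z : causalSetType d}.

Lemma exists_order_invariant (R : realType) (Y : set Z) :
  infinite_set Y -> down_set setT Y ->
  (forall A, stem Y A -> finite_set (minimals (Y `\` A))) ->
  exists mu : probability (g_sigma_algebraType (basic_events Z)) R,
    order_invariant mu.
Proof.
move=> infY downY finY.
have [f [f0 f_ge0 fH]] := exists_harmonic (children_notin finY)
  (children_neq0 infY finY) R.
have [z0 _] := infinite_setN0 infY.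
pose x v k := walk (children Y) z0 f k fset0 v.
pose X v : Omega Z :=
  if pselect (infinite_strings (x v)) is left xP then exist _ _ xP else point.
have stringX v : v \in `[0, 1[ -> string (X v) = x v.
  rewrite in_itv /X => v01; case: pselect => //= -[].
  exact: walk_infinite_string v01.
(* Ordered stems not contained in [Y] get weight 0. *)
pose weight (a : seq Z) : R :=
  if admissible (children Y) fset0 a then f [fset y in a]%fset else 0.
have preX k (a : k.-tuple Z) : exists2 l,
    `[0, 1[ `&` X @^-1` basic_event a = [set` `[l, l + weight a[] & 0 <= weight a.
  have [l [l0 lw lP]] := walk_itv z0 f_ge0 fH a (reachable0 _).
  exists l; last by rewrite /weight; case: ifP.
  move: lw lP; rewrite fset0U f0 -/(weight a) => lw lP.
  apply/seteqP; split=> v /=.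
  - rewrite in_itv /= => -[v01 Xa]; rewrite in_itv /=; apply/(lP _ v01) => i.
    rewrite size_tuple => ik.
    by have := Xa (Ordinal ik); rewrite stringX ?in_itv// (tnth_nth z0).
  - rewrite in_itv /= => vl.
    have v01 : 0 <= v < 1.
      by case/andP: vl => lv vlw; rewrite (le_trans l0 lv) (lt_le_trans vlw lw).
    split; first by rewrite in_itv.
    move=> i; rewrite stringX ?in_itv// (tnth_nth z0).
    by apply: ((lP _ v01).2 vl); rewrite size_tuple.
have [|mu muE] := @pushforward_unit_interval R _ (basic_events Z) X.
  by move=> _ [k [a [_ ->]]]; have [l -> _] := preX k a; exact: measurable_itv.
have mu_basic k (a : k.-tuple Z) : ordered_stem a ->
    mu (basic_event a) = (weight a)%:E.
  move=> sa; rewrite muE; last by exists k, a.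
  have [l -> w0] := preX k a.
  rewrite lebesgue_measure_itv /= lte_fin ltrDl; case: ltP => [_|wle0].
    by rewrite -EFinD addrAC subrr add0r.
  by congr EFin; apply/eqP; rewrite eq_le w0 wle0.
exists mu => k a s b sa sb; rewrite !mu_basic//; congr EFin.
have ab : tval b =i tval a.
  move=> y; apply/tnthP/tnthP => -[i ->].
    by exists (s i); rewrite tnth_mktuple.
  by exists ((s^-1)%g i); rewrite tnth_mktuple permKV.
have -> : weight b = weight a; last by [].
rewrite /weight; have -> : [fset y in tval b]%fset = [fset y in tval a]%fset :> {fset Z}.
  by apply/fsetP => y; rewrite !inE ab.
(* For an ordered stem, admissibility means inclusion in [Y], which ignores the order. *)
suff -> : admissible (children Y) fset0 b = admissible (children Y) fset0 a by [].
apply/idP/idP => /ordered_stem_admissible H; apply/ordered_stem_admissible => //.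
- by move=> y /=; rewrite -ab; exact: H.
- by move=> y /=; rewrite ab; exact: H.
Qed.

End OrderInvariantMeasure.

Theorem theorem7p1 (R : realType) (d : Order.disp_t) (Z : causalSetType d) :
  ((forall A : set Z, stem setT A -> finite_set (minimals (setT `\` A))) ->
     exists mu : probability (g_sigma_algebraType (basic_events Z)) R,
       order_invariant mu) /\
  ((exists Y : set Z,
      [/\ infinite_set Y,
          down_set setT Y &
          forall A : set Z,
            stem Y A -> finite_set (minimals (Y `\` A))]) ->
     exists mu : probability (g_sigma_algebraType (basic_events Z)) R,
       order_invariant mu).
Proof.
split=> [finT|[Y [infY downY finY]]]; last exact: exists_order_invariant finY.
(* The first claim is the case [Y = setT]. *)
apply: exists_order_invariant finT => //.
by rewrite (eq_finite_set (@causal_denumerable d Z)); exact: infinite_nat.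
Qed.
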